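(* Let $E$ be an infinite-dimensional vector space, $V$ a finite-dimensional subspace of $E$, $(e_i)_{i \in I}$ a family of vectors in $E$, and $J$ an infinite set. Suppose that: 1. There exist two functions $u : \mathcal{P}_{\omega,*}(I) \to I$ and $G : \mathcal{P}_{\omega,*}(I) \to \mathcal{P}_{\omega,*}(I)$ such that for all $I^* \in \mathcal{P}_{\omega,*}(I)$, $u(I^* ) \in I^*$ and $I^* \subseteq G(I^* )$; 2. There exists a function $T$ assigning to each $(I^*,j) \in \mathcal{P}_{\omega,*}(I) \times J$ a linear operator $T(I^*,j) \in L(\mathrm{span}(e_i)_{i \in G(I^* )},E)$; 3. There exist a finite subset $J_0$ of $J$ and a relation $R$ on $J$ such that $R[j] \subseteq J_0$ for all $j \in J_0$, and for every $j \in J$ there exists $n_j \in \mathbb{N}$ with $R^{n_j}[j] \subseteq J_0$; 4. For all $I^* \in \mathcal{P}_{\omega,*}(I)$ and all $i \in G(I^* )$, $\dim \mathrm{span}\{T(I^*,j) e_i\}_{j \in J} = \infty$; 5. For all $(I^*,j) \in \mathcal{P}_{\omega,*}(I) \times J$ and all $i \in G(I^* ) \setminus \{u(I^* )\}$, \[T(I^*,j)e_i \in \mathrm{span}\{T(I^*,j')e_{i'}\}_{(j',i')\in R[j] \times G(I^* )} + V.\] Then $(e_i)_{i \in I}$ is free.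
   Context: Vector spaces are over a field. $L(E,F)$ denotes the set of linear operators from $E$ to $F$. A family of vectors is free if it is linearly independent (as a family). $\mathbb{N} = \{0,1,2,\dots\}$. For a set $A$, $\mathcal{P}_{\omega,*}(A) = \{B \subseteq A : 0 < |B| < \infty\}$ is the set of nonempty finite subsets of $A$. A relation $R$ on a set $J$ is a subset of $J \times J$. For $S \subseteq J$, the direct image is $R[S] = \{y \in J : \exists x \in S,\ (x,y) \in R\}$, and for $j \in J$ one writes $R[j]$ for $R[\{j\}]$. The composition of relations on $J$ is $R_1 \circ R_2 = \{(x,z) \in J\times J : \exists y \in J,\ (x,y) \in R_1 \text{ and } (y,z) \in R_2\}$. $R^0 = \{(x,x) : x \in J\}$ and $R^n = R \circ R^{n-1}$ for $n \geq 1$. *)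

(* Defs.v *)
From HB Require Import structures.
From mathcomp Require Import all_boot all_algebra.
From mathcomp Require Import boolp classical_sets functions cardinality.

Set Implicit Arguments.
Unset Strict Implicit.
Unset Printing Implicit Defensive.

Import GRing.Theory.

Local Open Scope classical_set_scope.
Local Open Scope ring_scope.

(* [E] is an arbitrary left module over a field, hence a vector space of any
   dimension; the library's [vectType] only covers the finite-dimensional case,
   so spans, dimension and freeness are defined here over [set E]. *)

Section LinearAlgebra.
Context {K : fieldType} {E : lmodType K}.

Definition is_subspace (U : set E) : Prop :=
  U 0 /\ forall (a : K) (x y : E), U x -> U y -> U (a *: x + y).

Definition lspan (A : set E) : set E := smallest is_subspace A.

Definition finite_dim (U : set E) : Prop :=
  exists A : set E, finite_set A /\ U = lspan A.

Definition lfree {I : Type} (e : I -> E) : Prop :=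
  forall (n : nat) (f : 'I_n -> I) (c : 'I_n -> K), injective f ->
    \sum_(k < n) c k *: e (f k) = 0 -> forall k, c k = 0.

Definition addset (A B : set E) : set E := [set x + y | x in A & y in B].

Lemma is_subspace_lspan (A : set E) : is_subspace (lspan A).
Proof.
split=> [U [[U0 _] _]//|a x y Ax Ay U UA].
have [[_ UD] _] := UA; apply: UD; [exact: Ax UA | exact: Ay UA].
Qed.

Definition in_lspan (A : set E) : {pred E} := [pred x | x \in lspan A].

Lemma in_lspan_submod_closed (A : set E) : submod_closed (in_lspan A).
Proof.
have [A0 AD] := is_subspace_lspan A.
split=> [|a x y]; rewrite ?inE //; exact: AD.
Qed.

HB.instance Definition _ (A : set E) :=
  GRing.isSubmodClosed.Build K E (in_lspan A) (in_lspan_submod_closed A).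

Record lspan_type (A : set E) : Type := InLspan {
  lspan_val :> E;
  lspan_valP : lspan_val \in in_lspan A
}.

HB.instance Definition _ (A : set E) := [isSub of lspan_type A for @lspan_val A].
HB.instance Definition _ (A : set E) := [Choice of lspan_type A by <:].
HB.instance Definition _ (A : set E) :=
  [SubChoice_isSubLmodule of lspan_type A by <:].

Lemma mem_lspan_image {I : Type} (e : I -> E) (S : set I) (i : S) :
  e (val i) \in in_lspan (e @` S).
Proof.
apply/mem_set => U [_]; apply; exists (val i) => //; exact: set_valP.
Qed.

Definition lspan_gen {I : Type} (e : I -> E) (S : set I) (i : S) :
  lspan_type (e @` S) := InLspan (mem_lspan_image e i).

End LinearAlgebra.

Definition nefset (I : Type) : Type :=
  {A : set I | A !=set0 /\ finite_set A}.

Definition nefset_val {I : Type} (A : nefset I) : set I := proj1_sig A.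
Coercion nefset_val : nefset >-> set.

Section Relations.
Context {J : Type}.

Definition rel_image (R : set (J * J)) (S : set J) : set J :=
  [set y | exists x, S x /\ R (x, y)].

(* [(B \; A)%relation] relates [x] to [z] through [A] first and then [B], so
   [Q \; R] is R o Q with the convention that R o Q applies [R] first. *)
Definition rel_iter (n : nat) (R : set (J * J)) : set (J * J) :=
  iter n (fun Q => (Q \; R)%relation) diagonal.

End Relations.

(* Main.v *)
(** Let [A] collect the indices occurring with nonzero coefficients in a
    nontrivial linear dependency.  Then [e (u A)] is a combination of the other
    [e i] with [i] in [A], so the inclusion of hypothesis 5 extends to
    [i = u A].  Iterating [R] then puts every [T A j (e i)] into the subspace
    spanned by [V] and the vectors [T A j' (e i')] with [j'] in [J0] and [i'] in
    [G A].  This space is finite-dimensional, contradicting hypothesis 4. *)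
Require Import Defs.
From HB Require Import structures.
From mathcomp Require Import all_boot all_algebra.
From mathcomp Require Import boolp classical_sets functions cardinality.

Set Implicit Arguments.
Unset Strict Implicit.
Unset Printing Implicit Defensive.

Import GRing.Theory.

Local Open Scope classical_set_scope.
Local Open Scope ring_scope.

Section Subspaces.
Context {K : fieldType} {E : lmodType K}.
Implicit Types (U W : set E) (A B : set E) (x y : E).

Lemma subspaceZ U a x : is_subspace U -> U x -> U (a *: x).
Proof. by move=> [U0 UD] Ux; rewrite -[a *: x]addr0; exact: UD. Qed.

Lemma subspaceD U x y : is_subspace U -> U x -> U y -> U (x + y).
Proof. by move=> [_ UD] Ux Uy; rewrite -[x]scale1r; exact: UD. Qed.

Lemma subspace_sum U (T : Type) (r : seq T) (P : pred T) (F : T -> E) :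
  is_subspace U -> (forall t, P t -> U (F t)) -> U (\sum_(t <- r | P t) F t).
Proof.
move=> sU UF; apply: (big_ind U) => //; first by case: sU.
by move=> x y; exact: subspaceD.
Qed.

Lemma lspan_sub A U : is_subspace U -> A `<=` U -> lspan A `<=` U.
Proof. exact: smallest_sub. Qed.

Lemma sub_lspan A : A `<=` lspan A.
Proof. exact: sub_gen_smallest. Qed.

Lemma lspanS A B : A `<=` B -> lspan A `<=` lspan B.
Proof.
move=> AB; apply: lspan_sub; first exact: is_subspace_lspan.
by move=> x /AB; exact: sub_lspan.
Qed.

Lemma is_subspace_addset U W :
  is_subspace U -> is_subspace W -> is_subspace (addset U W).
Proof.
move=> [U0 UD] [W0 WD]; split; first by exists 0 => //; exists 0; rewrite ?addr0.
move=> a _ _ [x Ux [y Wy <-]] [x' Ux' [y' Wy' <-]].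
exists (a *: x + x'); first exact: UD.
exists (a *: y + y'); first exact: WD.
by rewrite scalerDr addrACA.
Qed.

(** Dividing by [c k0] solves the relation for [x k0]. Terms with zero coefficient vanish, so
    membership in [U] is asked only where [c k] is nonzero; the other [x k] may be arbitrary. *)
Lemma subspace_lin_dep U n (c : 'I_n -> K) (x : 'I_n -> E) k0 :
  is_subspace U -> c k0 != 0 -> \sum_k c k *: x k = 0 ->
  (forall k, k != k0 -> c k != 0 -> U (x k)) -> U (x k0).
Proof.
move=> sU c0; rewrite (bigD1 k0) //= => /eqP; rewrite addr_eq0 => /eqP cx Ux.
rewrite -[x k0](scalerK c0) cx -scaleN1r.
do 2![apply: subspaceZ => //]; apply: subspace_sum => // k kk0.
have [->|ck0] := eqVneq (c k) 0; first by rewrite scale0r; case: sU.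
by apply: subspaceZ => //; exact: Ux.
Qed.

(** The vectors of the form [a *: x + z] make up a subspace containing [x :: s], so minimality of
    the span applies. *)
Lemma lspan_cons x (s : seq E) y : lspan [set` x :: s] y ->
  exists a, exists2 z, lspan [set` s] z & y = a *: x + z.
Proof.
have [s0 sD] := is_subspace_lspan [set` s].
pose U := [set y | exists a, exists2 z, lspan [set` s] z & y = a *: x + z].
move: y; change (lspan [set` x :: s] `<=` U); apply: lspan_sub.
  split; first by exists 0, 0; rewrite // scale0r addr0.
  move=> a _ _ [b [z sz ->]] [b' [z' sz' ->]].
  exists (a * b + b'), (a *: z + z'); first exact: sD.
  by rewrite scalerDr scalerDl scalerA addrACA.
move=> y /=; rewrite inE => /orP[/eqP ->|ys].
  by exists 1, 0; rewrite // scale1r addr0.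
by exists 0, y; rewrite ?scale0r ?add0r//; exact: sub_lspan.
Qed.

(** Induction on the generators [x :: s]. If [U] is not inside the span of [s], some [y] in [U] has
    a nonzero coefficient on [x], and [U] is generated by [y] together with its intersection with
    the span of [s]. *)
Lemma finite_dim_subspace U A :
  finite_set A -> is_subspace U -> U `<=` lspan A -> finite_dim U.
Proof.
move=> /finite_seqP[s ->] {A}; elim: s U => [|x s IHs] U sU Us.
  exists [set` [::]]; split=> //; apply/seteqP; split=> //.
  by apply: lspan_sub => // y.
have [Us'|/existsNP[y /not_implyP[Uy nsy]]] := pselect (U `<=` lspan [set` s]).
  exact: IHs sU Us'.
have [a [z sz yE]] := lspan_cons (Us _ Uy).
have a0 : a != 0.
  by apply: contra_notN nsy => /eqP a0; rewrite yE a0 scale0r add0r.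
have sS := is_subspace_lspan [set` s].
have [|B [finB BE]] := IHs (U `&` lspan [set` s]) _ (@subIsetr _ _ _).
  case: sU sS => [U0 UD] [s0 sD]; split=> // b v w [Uv sv] [Uw sw].
  by split; [exact: UD|exact: sD].
exists (y |` B); split; first by rewrite finite_setU.
apply/seteqP; split=> [v Uv|].
  have [b [w sw vE]] := lspan_cons (Us _ Uv).
  (* With [y = a *: x + z] and [v = b *: x + w], subtracting [(b / a) *: y] cancels the [x]
     component and leaves a vector of [U] in the span of [s]. *)
  have vyE : v = (b / a) *: y + (- (b / a) *: y + v).
    by rewrite addrA -scalerDl subrr scale0r add0r.
  rewrite vyE; have sB := is_subspace_lspan (y |` B).
  apply: (subspaceD sB).
    by apply: (subspaceZ _ sB); apply: sub_lspan; left.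
  apply: (lspanS (@subsetUr _ [set y] B)); rewrite -BE; split.
    by apply: (subspaceD sU) => //; exact: (subspaceZ _ sU).
  rewrite vE yE scalerDr scalerA mulNr divfK // addrACA -scalerDl addNr scale0r.
  by rewrite add0r; case: sS => _; exact.
apply: lspan_sub => // v [->//|Bv].
by have [] : (U `&` lspan [set` s]) v by rewrite BE; exact: sub_lspan.
Qed.

Lemma finite_dim_addset A U :
  finite_set A -> finite_dim U ->
  exists2 B, finite_set B & addset (lspan A) U `<=` lspan B.
Proof.
move=> finA [B [finB ->]]; exists (A `|` B); first by rewrite finite_setU.
move=> _ [x Ax [y By <-]]; apply: (subspaceD (is_subspace_lspan _)).
  exact: lspanS Ax.
exact: lspanS By.
Qed.

End Subspaces.

Lemma finite_set_type (I : Type) (A : set I) :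
  finite_set A -> finite_set [set: A].
Proof.
move=> finA; rewrite (_ : setT = (val : A -> I) @^-1` A).
  by apply: finite_preimage => // x y _ _; exact: val_inj.
by apply/seteqP; split=> // x _; exact: set_valP.
Qed.

(** The second sum is [phi w], where [w] is the same combination formed in the span viewed as a
    type; [w] is zero because its underlying vector is. *)
Lemma linear_lspan_gen_sum (K : fieldType) (E : lmodType K) (I : Type)
    (e : I -> E) (S : set I) (phi : {linear lspan_type (e @` S) -> E})
    n (c : 'I_n -> K) (g : 'I_n -> S) :
  \sum_k c k *: e (val (g k)) = 0 ->
  \sum_k c k *: phi (lspan_gen e (g k)) = 0.
Proof.
move=> ce0; pose w : lspan_type (e @` S) := \sum_k c k *: lspan_gen e (g k).
transitivity (phi w).
  by rewrite linear_sum; under [RHS]eq_bigr do rewrite linearZ.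
suff -> : w = 0 by rewrite linear0.
apply: val_inj; rewrite raddf0 raddf_sum -[RHS]ce0; exact: eq_bigr.
Qed.

Theorem proposition6p1 (K : fieldType) (E : lmodType K)
    (V : set E) (I : Type) (e : I -> E) (J : Type)
    (u : nefset I -> I) (G : nefset I -> nefset I)
    (T : forall (A : nefset I) (j : J), {linear lspan_type (e @` G A) -> E})
    (J0 : set J) (R : set (J * J)) :
  ~ finite_dim [set: E] ->
  is_subspace V -> finite_dim V ->
  infinite_set [set: J] ->
  (forall A : nefset I, u A \in (A : set I) /\ (A : set I) `<=` G A) ->
  finite_set J0 ->
  (forall j : J, J0 j -> rel_image R [set j] `<=` J0) ->
  (forall j : J, exists n : nat, rel_image (rel_iter n R) [set j] `<=` J0) ->
  (forall (A : nefset I) (i : G A),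
     ~ finite_dim (lspan [set T A j (lspan_gen e i) | j in [set: J]])) ->
  (forall (A : nefset I) (j : J) (i : G A), val i <> u A ->
     addset
       (lspan [set T A j' (lspan_gen e i') |
                j' in rel_image R [set j] & i' in [set: G A]]) V
       (T A j (lspan_gen e i))) ->
  lfree e.
Proof.
move=> _ sV fV _ uG finJ0 RJ0 RnJ0 Tinf TRV n f c finj cf0.
apply: contrapT => /existsNP[k0 /eqP ck0].
have neA : f @` [set k | c k != 0] !=set0 by exists (f k0); exists k0.
have finA : finite_set (f @` [set k | c k != 0]) by exact: finite_image.
pose A : nefset I := exist _ (f @` [set k | c k != 0]) (conj neA finA).
(* Since [u A] lies in [A], [k0] can be rechosen so that [f k0 = u A]. *)
have [/set_mem[{ck0}k0 ck0 fk0] AG] := uG A.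
(* [g] lifts [f] to the index type [G A]. Where [c k = 0], [f k] may fall outside [G A], and [g k]
   takes the default value [u A]. *)
have /choice[g gE] k : exists i : G A, c k != 0 -> val i = f k.
  have Gu : f k0 \in (G A : set I) by apply/mem_set/AG; exists k0.
  have [_|ck] := eqVneq (c k) 0; first by exists (SigSub Gu).
  have Gk : f k \in (G A : set I) by apply/mem_set/AG; exists k.
  by exists (SigSub Gk).
pose W S :=
  addset (lspan [set T A j (lspan_gen e i) | j in S & i in [set: G A]]) V.
have sW S : is_subspace (W S).
  by apply: is_subspace_addset => //; exact: is_subspace_lspan.
have TW j i : W (rel_image R [set j]) (T A j (lspan_gen e i)).
  have [iu|] := pselect (val i = u A); last exact: TRV.
  have -> : i = g k0 by apply: val_inj; rewrite gE // iu fk0.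
  (* [T A j] carries the dependency over to the images. By injectivity of [f], the remaining nonzero
     terms have an index other than [u A], so hypothesis 5 covers them. *)
  apply: (@subspace_lin_dep _ _ _ _ c (fun k => T A j (lspan_gen e (g k)))) => //.
    apply: linear_lspan_gen_sum; rewrite -[RHS]cf0; apply: eq_bigr => k _.
    by have [->|ck] := eqVneq (c k) 0; rewrite ?scale0r // gE.
  move=> k kk0 ck; apply: TRV; rewrite gE // -fk0 => /finj kE.
  by rewrite kE eqxx in kk0.
have TW0 m j i : rel_image (rel_iter m R) [set j] `<=` J0 ->
    W J0 (T A j (lspan_gen e i)).
  elim: m j i => [|m IHm] j i RmJ0.
    (* The zeroth iterate is the diagonal, so [j] itself lies in [J0]. *)
    exists (T A j (lspan_gen e i)); last by exists 0; [case: sV|rewrite addr0].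
    by apply: sub_lspan; exists j; [apply: RmJ0; exists j|exists i].
  have [x + [y Vy <-]] := TW j i.
  move=> Rx; apply: (subspaceD (sW J0)); last first.
    exists 0; last by exists y; rewrite ?add0r.
    by case: (is_subspace_lspan
      [set T A j (lspan_gen e i) | j in J0 & i in [set: G A]]).
  move: x Rx; apply: lspan_sub => // _ [j' [_ [-> Rjj']] [i' _ <-]].
  (* [rel_iter] applies [R] first: [m] steps from a successor [j'] of [j] are [m.+1] steps from [j],
     hence end in [J0]. *)
  apply: IHm => z [_ [-> Rz]]; apply: RmJ0; exists j; split=> //.
  by exists j'.
apply: (Tinf A (g k0)).
have [|B finB WB] := @finite_dim_addset _ _
    [set T A j (lspan_gen e i) | j in J0 & i in [set: G A]] V _ fV.
  by apply: finite_image2 => //; apply: finite_set_type; case: (proj2_sig (G A)).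
apply: (finite_dim_subspace finB); first exact: is_subspace_lspan.
apply: subset_trans WB; apply: (lspan_sub (sW J0)) => _ [j _ <-].
by have [m] := RnJ0 j; exact: TW0.
Qed.
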